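(* Let $a,b,c>1$ be integers and let $r,z>1$ be odd integers, with $a\equiv 2\pmod 4$, $b\equiv 3\pmod 4$, $\gcd(a,b)=1$. Let $y$ be a positive integer with $(y,z)\neq(2,r)$. If $a$ or $b$ is a prime power, then the simultaneous equations $$a^2+b^2=c^r,\qquad a^2+b^y=c^z$$ do not both hold.
   Context: A prime power is an integer of the form $p^s$ with $p$ prime and $s\ge 1$. *)

(* Defs.v *)
From mathcomp Require Import all_boot.

Definition prime_power (n : nat) : Prop :=
  exists p s : nat, [/\ prime p, 1 <= s & n = p ^ s].

(* Main.v *)
Require Import Defs.
From HB Require Import structures.
From mathcomp Require Import all_boot all_order all_algebra.
From mathcomp Require Import ring zify.

(* Modulo 8, y is even and c = 5; write y = 2Y with Y > 1, so that r < z. In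
   Z[i] one gets b + a i = (u + v i)^r and b^Y + a i = (u' + v' i)^z with
   u^2 + v^2 = u'^2 + v'^2 = c, where u | b, u' | b^Y and v, v' | a.

   Let b = p^s. The exponents n for which (u' + v' i)^n is real modulo p form
   a group containing p + 1, since p = 3 modulo 4. As p^(sY) is nearly
   c^(z/2), lifting the exponent shows that z divides n as soon as 2n is such
   an exponent. Hence z divides p + 1, so p does not divide r, and p does not
   divide u', so u'^2 = 1. If p does not divide u, then u^2 = u'^2 and v^2 =
   v'^2, so z divides r, which is absurd. Otherwise lifting the exponent gives
   u^2 = b^2; since v'^2 divides a^2 and c - 1, it divides b^2 - 1, so c = 1 +
   v'^2 <= b^2 = u^2, forcing v = 0.

   If a is a prime power then a = 2, so v^2 = v'^2 = 4 and u^2 = u'^2. The same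
   group structure modulo b shows that r divides z and (u' + v' i)^r has real
   part b up to sign. Lifting the exponent at every prime factor of b shows that
   b^(Y-1) divides z/r, which contradicts z/r < Y. *)

Set Implicit Arguments.
Unset Strict Implicit.
Unset Printing Implicit Defensive.

Import Order.TTheory GRing.Theory Num.Theory.
Local Open Scope ring_scope.

(** * The ring of Gaussian integers, its conjugation and its norm *)

Record gint := Gint { gre : int; gim : int }.

Definition gint_pair (x : gint) := (gre x, gim x).
Definition pair_gint (x : int * int) := Gint x.1 x.2.
Lemma gint_pairK : cancel gint_pair pair_gint. Proof. by case. Qed.
HB.instance Definition _ := Choice.copy gint (can_type gint_pairK).

Definition gadd x y := Gint (gre x + gre y) (gim x + gim y).
Definition gopp x := Gint (- gre x) (- gim x).
Definition gmul x y :=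
  Gint (gre x * gre y - gim x * gim y) (gre x * gim y + gim x * gre y).

Lemma gaddA : associative gadd.
Proof. by case=> ? ? [? ?] [? ?]; congr Gint; rewrite /= addrA. Qed.
Lemma gaddC : commutative gadd.
Proof. by case=> ? ? [? ?]; congr Gint; rewrite /= addrC. Qed.
Lemma gadd0 : left_id (Gint 0 0) gadd.
Proof. by case=> ? ?; congr Gint; rewrite /= add0r. Qed.
Lemma gaddN : left_inverse (Gint 0 0) gopp gadd.
Proof. by case=> ? ?; congr Gint; rewrite /= addNr. Qed.
HB.instance Definition _ := GRing.isZmodule.Build gint gaddA gaddC gadd0 gaddN.

Lemma gmulA : associative gmul.
Proof. by case=> ? ? [? ?] [? ?]; congr Gint => /=; ring. Qed.
Lemma gmulC : commutative gmul.
Proof. by case=> ? ? [? ?]; congr Gint => /=; ring. Qed.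
Lemma gmul1 : left_id (Gint 1 0) gmul.
Proof. by case=> ? ?; congr Gint => /=; ring. Qed.
Lemma gmulD : left_distributive gmul gadd.
Proof. by case=> ? ? [? ?] [? ?]; congr Gint => /=; ring. Qed.
Lemma gone_neq0 : Gint 1 0 != 0. Proof. by []. Qed.
HB.instance Definition _ := GRing.Zmodule_isComNzRing.Build gint
  gmulA gmulC gmul1 gmulD gone_neq0.

Lemma greM x y : gre (x * y) = gre x * gre y - gim x * gim y.
Proof. by []. Qed.
Lemma gimM x y : gim (x * y) = gre x * gim y + gim x * gre y.
Proof. by []. Qed.
Lemma gintP x y : gre x = gre y -> gim x = gim y -> x = y.
Proof. by case: x y => ? ? [? ?] /= -> ->. Qed.

Definition gconj x := Gint (gre x) (- gim x).
Definition sqnorm x : int := gre x ^+ 2 + gim x ^+ 2.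

Lemma gconjM x y : gconj (x * y) = gconj x * gconj y.
Proof. by apply: gintP; rewrite /= ?greM ?gimM /=; ring. Qed.
Lemma gconjX x n : gconj (x ^+ n) = gconj x ^+ n.
Proof. by elim: n => // n IH; rewrite !exprS gconjM IH. Qed.
Lemma sqnormM x y : sqnorm (x * y) = sqnorm x * sqnorm y.
Proof. by rewrite /sqnorm greM gimM; ring. Qed.
Lemma sqnormX x n : sqnorm (x ^+ n) = sqnorm x ^+ n.
Proof. by elim: n => // n IH; rewrite !exprS sqnormM IH. Qed.
Lemma sqnorm_ge0 x : 0 <= sqnorm x.
Proof. by rewrite addr_ge0 ?sqr_ge0. Qed.
Lemma gint_natr n : n%:R = Gint n%:Z 0.
Proof.
elim: n => // n IH; rewrite mulrS IH; apply: gintP => //=; lia.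
Qed.
Lemma gint_intr m : m%:~R = Gint m 0.
Proof.
case: m => n; first exact: gint_natr.
by rewrite NegzE mulrNz -[X in - X]/(n.+1%:R) gint_natr; apply: gintP.
Qed.
Lemma mul_gconj x : x * gconj x = (sqnorm x)%:~R.
Proof.
rewrite gint_intr; apply: gintP; rewrite ?greM ?gimM /sqnorm /=; ring.
Qed.

(** * Euclidean division, units and coprime factorisation in Z[i] *)

Lemma round_div (e N : int) : 0 < N ->
  exists q, - N <= 2 * (e - N * q) <= N.
Proof.
move=> N0; exists ((2 * e + N) %/ (2 * N))%Z.
have d0 : 0 < 2 * N by lia.
have := divz_eq (2 * e + N) (2 * N); have := modz_ge0 (2 * e + N) (lt0r_neq0 d0).
have := ltz_pmod (2 * e + N) d0.
set q := (_ %/ _)%Z; set w := (_ %% _)%Z; nia.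
Qed.

(** Rounding both coordinates of [x * gconj y] divided by the norm [N] of [y] leaves errors of at
    most [N / 2]. The norm of the remainder times [N] is the sum of their squares, at most
    [N ^ 2 / 2]. *)
Lemma gint_divmod x y : y != 0 -> exists q, sqnorm (x - y * q) < sqnorm y.
Proof.
move=> y0.
have N0 : 0 < sqnorm y.
  rewrite lt0r sqnorm_ge0 andbT; apply/negP => /eqP h.
  case/negP: y0; apply/eqP; case: y h => y1 y2; rewrite /sqnorm /= => h.
  by apply: gintP => /=; nia.
have [q1 h1] := round_div (gre (x * gconj y)) N0.
have [q2 h2] := round_div (gim (x * gconj y)) N0.
exists (Gint q1 q2); rewrite -(ltr_pM2r N0).
have -> : sqnorm (x - y * Gint q1 q2) * sqnorm y =
  (gre (x * gconj y) - sqnorm y * q1) ^+ 2 +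
  (gim (x * gconj y) - sqnorm y * q2) ^+ 2.
  case: x y {N0 h1 h2 y0} => x1 x2 [y1 y2].
  by rewrite /sqnorm /= ; ring.
move: h1 h2; set s := _ - _ * q1; set t := _ - _ * q2; set N := sqnorm y in N0 *.
move=> h1 h2; nia.
Qed.

(** Euclid's algorithm, by induction on the norm of [y]; the cofactors [x'] and [y'] record that [g]
    is a common divisor. *)
Lemma gint_bezout (x y : gint) :
  exists g s t x' y' : gint, [/\ g = x * s + y * t, x = g * x' & y = g * y'].
Proof.
have [n] := ubnP `|sqnorm y|%N.
elim: n x y => // n IH x y; rewrite ltnS => hn.
have [->|y0] := eqVneq y 0.
  by exists x, 1, 0, 1, 0; split; rewrite ?mulr1 ?mulr0 ?addr0.
have [q hq] := gint_divmod x y0.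
have hw : (`|sqnorm (x - y * q)%R| < n)%N.
  have := sqnorm_ge0 (x - y * q); move: (sqnorm (x - y * q)) (sqnorm y) hn hq; lia.
have [//|g [s [t [x' [y' [hg hx hy]]]]]] := IH y (x - y * q).
exists g, t, (s - q * t), (y' + x' * q), x'; split=> //.
  by rewrite hg; ring.
by rewrite mulrDr -hy mulrA -hx; ring.
Qed.

Lemma sqnorm1_exp4 e : sqnorm e = 1 -> e ^+ 4 = 1.
Proof.
case: e => e1 e2; rewrite /sqnorm /= => h.
have [b1 b2] : -1 <= e1 <= 1 /\ -1 <= e2 <= 1 by split; nia.
have [h1|[h1|h1]] : e1 = 1 \/ e1 = -1 \/ e1 = 0 by lia.
- have -> : e2 = 0 by nia.
  by rewrite h1; apply: gintP.
- have -> : e2 = 0 by nia.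
  by rewrite h1; apply: gintP.
have [->|->] : e2 = 1 \/ e2 = -1 by nia.
  by rewrite h1; apply: gintP.
by rewrite h1; apply: gintP.
Qed.

(* If [g] is a gcd of [x = a + b i] and [c], then [x] and its conjugate being
   coprime forces [x] and [g ^+ r] to be associate; as [r] is odd, the unit
   between them is itself an [r]-th power. *)
Lemma coprime_sum_squares_power (a b c : int) r :
  coprimez a b -> odd r -> ~~ (2 %| c)%Z -> a ^+ 2 + b ^+ 2 = c ^+ r ->
  exists x, Gint a b = x ^+ r.
Proof.
move=> cab r_odd c_odd eqc.
set x := Gint a b.
have Nx : sqnorm x = c ^+ r by [].
have c0 : c != 0 by apply: contraNneq c_odd => ->.
have cr0 : c ^+ r != 0 by rewrite expf_neq0.
have xxb : x * gconj x = c%:~R ^+ r by rewrite mul_gconj Nx rmorphXn.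
have [S [T ST]] : exists S T, x * S + gconj x * T = 1.
  have /coprimezP[[A B] /= AB] := cab.
  have cr_odd : ~~ (2 %| c ^+ r)%Z.
    apply: contra c_odd; rewrite !dvdzE abszX => h.
    by move: h; rewrite Euclid_dvdX // => /andP[].
  have [k hk] : exists k, c ^+ r = 1 + 2 * k.
    by exists ((c ^+ r - 1) %/ 2)%Z; lia.
  have i2 : Gint 0 1 ^+ 2 = -1 by apply: gintP.
  (* With [a * A + b * B = 1], the number 2 is [(x + gconj x) * A + (gconj x - x) * i * B], and 1 is
     the odd norm [x * gconj x] minus [2 * k]; collecting terms gives these cofactors. *)
  exists (gconj x - k%:~R * (A%:~R - Gint 0 1 * B%:~R)).
  exists (- k%:~R * (A%:~R + Gint 0 1 * B%:~R)).
  have xE : x = a%:~R + Gint 0 1 * b%:~R.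
    by rewrite !gint_intr; apply: gintP; rewrite /= ?greM ?gimM /=; lia.
  have xbE : gconj x = a%:~R - Gint 0 1 * b%:~R.
    by rewrite !gint_intr; apply: gintP; rewrite /= ?greM ?gimM /=; lia.
  have hab : a%:~R * A%:~R + b%:~R * B%:~R = 1 :> gint.
    by rewrite -!rmorphM -rmorphD [a * A]mulrC [b * B]mulrC AB.
  have hc : x * gconj x = 1 + 2 * k%:~R.
    by rewrite mul_gconj Nx hk rmorphD rmorphM.
  transitivity (x * gconj x - k%:~R * ((x + gconj x) * A%:~R
     + (gconj x - x) * Gint 0 1 * B%:~R)); first by ring.
  rewrite hc xbE xE.
  transitivity (1 + 2 * k%:~R - 2 * k%:~R *
    (a%:~R * A%:~R - Gint 0 1 ^+ 2 * (b%:~R * B%:~R)) : gint); first by ring.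
  by rewrite i2 mulN1r opprK hab; ring.
have [g [s [t [x' [c' [hg hx hc]]]]]] := gint_bezout x c%:~R.
have [W [V gW]] : exists W V, g ^+ r * W + gconj x * V = 1.
  elim: r {r_odd eqc Nx cr0 xxb} => [|r [W [V IH]]].
    by exists 1, 0; rewrite mulr0 addr0 mulr1.
  exists (W * (x' * S)), (g ^+ r * W * T + V).
  transitivity (g ^+ r * W * (g * x' * S + gconj x * T) + gconj x * V).
    by rewrite exprS; ring.
  by rewrite -hx ST mulr1 IH.
(* In the expansion of [(x * s + c * t) ^+ r], every term but [c ^+ r * t ^+ r] has a factor [x],
   and [c ^+ r] is [x * gconj x]. *)
have [M xM] : exists M, g ^+ r = x * M.
  suff [M hM] : exists M, g ^+ r = x * M + c%:~R ^+ r * t ^+ r.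
    by exists (M + gconj x * t ^+ r); rewrite hM -xxb; ring.
  rewrite hg; elim: r {r_odd eqc Nx cr0 xxb W V gW} => [|r [M IH]].
    by exists 0; rewrite !expr0; ring.
  exists (s * (x * M + c%:~R ^+ r * t ^+ r) + M * c%:~R * t).
  by rewrite exprSr IH !exprSr; ring.
(* [g ^+ r] is prime to [gconj x] and divides [c ^+ r = x * gconj x], so it divides [x]. *)
have [e xe] : exists e, x = g ^+ r * e.
  exists (x * W + c' ^+ r * V).
  transitivity (x * (g ^+ r * W + gconj x * V)); first by rewrite gW mulr1.
  by rewrite mulrDr (mulrA x (gconj x)) xxb hc exprMn; ring.
have Ne : sqnorm e = 1.
  have : sqnorm x = sqnorm x * (sqnorm M * sqnorm e) by rewrite -!sqnormM {1}xe xM mulrA.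
  rewrite Nx -{1}[c ^+ r]mulr1 => /(mulfI cr0).
  have := sqnorm_ge0 e; have := sqnorm_ge0 M.
  move: (sqnorm M) (sqnorm e) => m n m0 n0 mn.
  have m1 : 0 < m by rewrite lt0r m0 andbT; apply: contra_eq_neq mn => ->; rewrite mul0r.
  have n1 : 0 < n by rewrite lt0r n0 andbT; apply: contra_eq_neq mn => ->; rewrite mulr0.
  nia.
exists (g * e ^+ r); rewrite exprMn -exprM xe; congr (_ * _).
(* An odd square is 1 modulo 4 and [e ^+ 4 = 1], so [e ^+ (r * r) = e]. *)
have [k ->] : exists k, (r * r = 4 * k + 1)%N.
  exists (r./2 * r./2 + r./2)%N.
  move: (odd_double_half r); rewrite r_odd; set h := r./2; nia.
by rewrite exprD exprM sqnorm1_exp4 // expr1n mul1r.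
Qed.

(** * Real and imaginary parts of powers, and their divisors *)

Lemma dvdz_Euclid (p : nat) (m n : int) : prime p ->
  (p %| m * n)%Z = (p %| m)%Z || (p %| n)%Z.
Proof. by move=> pp; rewrite !dvdzE abszM Euclid_dvdM. Qed.

Lemma dvdz_EuclidX (p n : nat) (m : int) : prime p ->
  (p %| m ^+ n)%Z = (p %| m)%Z && (0 < n)%N.
Proof. by move=> pp; rewrite !dvdzE abszX Euclid_dvdX. Qed.

Lemma coprimez_primeX (p k : nat) (m : int) : prime p ->
  ~~ (p %| m)%Z -> coprimez (p%:Z ^+ k) m.
Proof.
by move=> pp pm; rewrite coprimezXl // coprimezE prime_coprime // -dvdzE.
Qed.

(** Binomial expansion of [(x + y i) ^+ n] with [n = k.*2.+1], cut at the lowest order in [x]. The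
    leading term of the real part carries the factor [n * x], which is what lifting the exponent
    uses. *)
Lemma odd_power_gint x y k : exists w w',
  Gint x y ^+ k.*2.+1 =
  Gint (x * ((-1) ^+ k * k.*2.+1%:R * y ^+ k.*2 + x ^+ 2 * w))
       ((-1) ^+ k * y ^+ k.*2.+1 + x ^+ 2 * w').
Proof.
elim: k => [|k [w [w' IH]]].
  by exists 0, 0; rewrite double0 !expr1 !expr0; congr Gint; ring.
exists ((-1) ^+ k * k.*2.+1%:R * y ^+ k.*2 + w * (x ^+ 2 - y ^+ 2) - 2 * y * w').
exists (2 * y * ((-1) ^+ k * k.*2.+1%:R * y ^+ k.*2 + x ^+ 2 * w)
        + w' * (x ^+ 2 - y ^+ 2) + (-1) ^+ k * y ^+ k.*2.+1).
have -> : k.+1.*2.+1 = (2 + k.*2.+1)%N by [].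
rewrite exprD IH; apply: gintP; rewrite expr2 ?greM ?gimM /= !exprS -!natr1; ring.
Qed.

Lemma gre_dvd_odd_power x n : odd n -> (gre x %| gre (x ^+ n))%Z.
Proof.
case: x => x y n_odd; rewrite -(odd_double_half n) n_odd add1n.
by have [w [w' ->]] := odd_power_gint x y n./2; rewrite dvdz_mulr.
Qed.

Lemma gim_dvd_power x n : (gim x %| gim (x ^+ n))%Z.
Proof.
elim: n => [|n IH]; first exact: dvdz0.
by rewrite exprS gimM; apply: rpredD; [apply: dvdz_mull|apply: dvdz_mulr].
Qed.

(* Multiplying by the conjugate replaces dividing by a power of [x] modulo [m]. *)
Lemma gim_dvd_gcd m x i j : coprimez m (sqnorm x) ->
  (m %| gim (x ^+ i))%Z -> (m %| gim (x ^+ j))%Z ->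
  (m %| gim (x ^+ gcdn i j))%Z.
Proof.
move=> cop mi mj; have [->|i0] := posnP i; first by rewrite gcd0n.
have mul n k : (m %| gim (x ^+ n))%Z -> (m %| gim (x ^+ (k * n)))%Z.
  by move=> h; apply: dvdz_trans h _; rewrite mulnC exprM gim_dvd_power.
case: (egcdnP j i0) => ki kj kij _.
have := mul _ ki mi; have := mul _ kj mj; rewrite kij exprD.
set y := x ^+ _; set t := x ^+ _ => my myt.
have : (m %| gim (y * t * gconj y))%Z.
  rewrite gimM; apply: rpredD; last exact: dvdz_mulr.
  by apply: dvdz_mull; rewrite /= rpredN.
have -> : y * t * gconj y = t * (sqnorm y)%:~R by rewrite -mul_gconj; ring.
rewrite gint_intr gimM /= mulr0 add0r Gauss_dvdzl //.
by rewrite sqnormX coprimezXr.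
Qed.

(** * Frobenius and lifting the exponent at a prime *)

Lemma exprD_prime (R : comNzRingType) p (x y : R) : prime p ->
  exists w, (x + y) ^+ p = x ^+ p + y ^+ p + p%:R * w.
Proof.
move=> pp; case: p pp => // p pp.
exists (\sum_(i < p) (x ^+ (p - i) * y ^+ i.+1) *+ ('C(p.+1, i.+1) %/ p.+1)).
rewrite exprDn big_ord_recl big_ord_recr /= subn0 bin0 subnn binn !expr0.
rewrite mulr1 mul1r !mulr1n addrAC -addrA; congr (_ + (_ + _)).
rewrite mulr_sumr; apply: eq_bigr => i _.
rewrite /bump /= add1n subSS -mulrnAr mulr_natl -mulrnA.
rewrite divnK ?prime_dvd_bin //=; last by rewrite !ltnS.
by rewrite mulrnAr.
Qed.

Lemma fermat_littlez (p : nat) (u : int) : prime p -> odd p ->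
  (p %| u ^+ p - u)%Z.
Proof.
move=> pp p_odd.
have pos (n : nat) : (p %| n%:Z ^+ p - n%:Z)%Z.
  by rewrite -eqz_mod_dvd -natz -natrX !natz !modz_nat fermat_little.
case: u => n; first exact: pos.
rewrite NegzE exprNn -signr_odd p_odd expr1 mulN1r -opprD rpredN; exact: pos.
Qed.

(* Raising to the power [p] is conjugation modulo [p], as [p] is inert. *)
Lemma gim_dvd_frobenius (p : nat) x : prime p -> (p %% 4 = 3)%N ->
  (p %| gim (x ^+ p.+1))%Z.
Proof.
move=> pp p4; case: x => u v.
have p_odd : odd p by lia.
have [w] := exprD_prime (Gint u 0) (Gint 0 v) pp.
have -> : Gint u 0 + Gint 0 v = Gint u v by apply: gintP => /=; lia.
have realX (t : int) n : Gint t 0 ^+ n = Gint (t ^+ n) 0.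
  by rewrite -!gint_intr rmorphXn.
have -> : Gint 0 v = Gint 0 1 * Gint v 0 by apply: gintP => /=; lia.
rewrite exprMn !realX gint_natr.
have -> : Gint 0 1 ^+ p = Gint 0 (-1).
  rewrite (divn_eq p 4) p4 exprD mulnC exprM.
  by have -> : Gint 0 1 ^+ 4 = 1 by []; rewrite expr1n.
case: w => w1 w2 h; rewrite exprSr h gimM /=.
have /dvdzP[s hs] := fermat_littlez u pp p_odd.
have /dvdzP[t ht] := fermat_littlez v pp p_odd.
apply/dvdzP; exists (s * v - t * u + w1 * v + w2 * u).
have -> : u ^+ p = s * p + u by rewrite -hs; ring.
have -> : v ^+ p = t * p + v by rewrite -ht; ring.
ring.
Qed.

(** Lifting the exponent for real parts, where [f] bounds the valuation of [x]. By induction on [k]: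
    the leading term forces [p] to divide [n], and passing to the [p]-th power of [x + y i] raises
    the valuation of the real part by exactly one. *)
Lemma dvdn_lifting (p f k n : nat) x y : prime p -> odd p -> odd n ->
  (p %| x)%Z -> ~~ (p%:Z ^+ f.+1 %| x)%Z -> ~~ (p %| y)%Z ->
  (p%:Z ^+ (f + k) %| gre (Gint x y ^+ n))%Z -> (p ^ k %| n)%N.
Proof.
move=> pp p_odd; elim: k f n x y => [|k IH] f n x y n_odd px pfx py.
  by rewrite dvd1n.
have ppow (m : int) : ~~ (p %| m)%Z -> ~~ (p%:Z ^+ f.+1 %| x * m)%Z.
  by move=> pm; rewrite Gauss_dvdzl // coprimez_primeX.
have sgnE (s : nat) (m : int) : (p %| (-1) ^+ s * m)%Z = (p %| m)%Z.
  by rewrite dvdz_Euclid // -signr_odd; case: (odd s) => /=; rewrite dvdzE /= dvdn1; lia.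
have px2 (m : int) : (p %| x ^+ 2 * m)%Z by rewrite -mulrA dvdz_mulr.
have half m : odd m -> m = m./2.*2.+1.
  by move=> m_odd; rewrite -[in LHS](odd_double_half m) m_odd.
move=> hn; have := hn; rewrite {1}(half _ n_odd).
have [w [w' ->]] /= := odd_power_gint x y n./2.
rewrite -(half _ n_odd) => h.
(* [p ^ f.+1] divides [x] times the bracket but not [x], so [p] divides the bracket, which is [n]
   times a unit modulo [p]. *)
have pn : (p %| n)%N.
  have pB : (p %| (-1) ^+ n./2 * n%:R * y ^+ n./2.*2 + x ^+ 2 * w)%Z.
    apply: contraLR h => /ppow; apply: contra => h; apply: dvdz_trans h.
    by rewrite addnS dvdz_exp2l // ltnS leq_addr.
  move: pB; rewrite rpredDr ?px2 // -mulrA sgnE dvdz_Euclid // dvdz_EuclidX //.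
  by rewrite (negbTE py) orbF natz.
have /dvdnP[n' nE] := pn.
have n'_odd : odd n' by move: n_odd; rewrite nE oddM => /andP[].
have [t [t' xyp]] := odd_power_gint x y p./2; rewrite -(half _ p_odd) in xyp.
have sgn_unit : ~~ (p %| (-1) ^+ p./2 * y ^+ p./2.*2)%Z.
  by rewrite sgnE dvdz_EuclidX // (negbTE py).
have /dvdzP[q xE] := px.
(* The real part of the [p]-th power is [p * x * m] with [m] prime to [p]; this needs [p] to divide
   [x]. *)
set m := (-1) ^+ p./2 * y ^+ p./2.*2 + p%:Z * (q ^+ 2 * t).
have pm : ~~ (p %| m)%Z by rewrite rpredDr // dvdz_mulr.
have xpE : x * ((-1) ^+ p./2 * p%:R * y ^+ p./2.*2 + x ^+ 2 * t) = p%:Z * (x * m).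
  by rewrite /m natz xE; ring.
rewrite xpE in xyp.
have p0 : p%:Z != 0 by have := prime_gt0 pp; lia.
rewrite nE expnS mulnC dvdn_pmul2r ?prime_gt0 //.
apply: (IH f.+1 _ (p%:Z * (x * m)) ((-1) ^+ p./2 * y ^+ p + x ^+ 2 * t')) => //.
- exact: dvdz_mulr.
- by rewrite exprS dvdz_mul2l // ppow.
- by rewrite rpredDr ?px2 // sgnE dvdz_EuclidX // (negbTE py).
by rewrite -xyp -exprM mulnC -nE addSnnS.
Qed.

(** * Exponents whose powers are real modulo [p] *)

Lemma expn5_gt_sq k : (2 < k)%N -> (25 * k ^ 2 < 24 * 5 ^ k.-1)%N.
Proof.
elim: k => // k IH; rewrite ltnS leq_eqVlt => /predU1P[<- //|k2].
have -> : (5 ^ k.+1.-1 = 5 * 5 ^ k.-1)%N by rewrite -expnS (ltn_predK k2).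
move: (IH k2).
have -> : (k.+1 ^ 2 = k ^ 2 + 2 * k + 1)%N by rewrite -addn1 sqrnD; lia.
have : (k * 3 <= k ^ 2)%N by rewrite -mulnn leq_mul.
by move: (5 ^ _)%N (k ^ 2)%N => P K; lia.
Qed.

(* If [g] is the gcd of [n] and [z] and [x] is the real part of [al ^+ g], then
   lifting the exponent bounds [p ^ m] by [`|x| * (z / g)], which is too small
   for [(p ^ m) ^ 2 + a ^ 2 = sqnorm al ^+ z] unless [z = g]. *)
Lemma real_power_mod_order (p z m n : nat) (a : int) al :
  prime p -> odd p -> odd z -> ~~ (p %| a)%Z -> (0 < m)%N ->
  al ^+ z = Gint (p%:Z ^+ m) a ->
  5 <= sqnorm al -> 25 * a ^+ 2 <= sqnorm al ^+ z ->
  (p %| gim (al ^+ n.*2))%Z -> (z %| n)%N.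
Proof.
move=> pp p_odd z_odd pa m0 alz c5 ac pn.
have eqN : sqnorm al ^+ z = p%:Z ^+ m ^+ 2 + a ^+ 2 by rewrite -sqnormX alz.
have pm : (p %| p%:Z ^+ m)%Z by rewrite dvdz_exp.
have cop : coprimez p (sqnorm al).
  rewrite -[p%:Z]expr1 coprimez_primeX //.
  have : ~~ (p %| sqnorm al ^+ z)%Z.
    rewrite eqN rpredDl; last by rewrite dvdz_exp.
    by rewrite dvdz_EuclidX // (negbTE pa).
  by apply: contra => h; rewrite dvdz_exp // odd_gt0.
(* The square of [p ^ m + a i] has imaginary part [2 * a * p ^ m], so [2 * z] is an admissible
   exponent, and with [2 * n] also twice the gcd of [z] and [n]. *)
have pz : (p %| gim (al ^+ z.*2))%Z.
  rewrite -muln2 exprM alz expr2 gimM /=.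
  by apply: rpredD; [apply: dvdz_mulr|apply: dvdz_mull].
have := gim_dvd_gcd cop pz pn.
rewrite -!muln2 -muln_gcdl; set g := gcdn z n.
have /dvdnP[k zE] : (g %| z)%N by rewrite dvdn_gcdl.
have [k_odd g_odd] : odd k /\ odd g by apply/andP; rewrite -oddM -zE.
rewrite exprM; case eb: (al ^+ g) => [x y].
have ebk : Gint x y ^+ k = Gint (p%:Z ^+ m) a by rewrite -eb -exprM mulnC -zE.
have py : ~~ (p %| y)%Z.
  apply: contra pa => py; have := gim_dvd_power (Gint x y) k.
  by rewrite ebk /=; apply: dvdz_trans.
rewrite expr2 gimM /= => h.
have px : (p %| x)%Z.
  move: h; rewrite [y * x]mulrC -mulr2n -mulr_natr !dvdz_Euclid // (negbTE py).
  rewrite orbF natz => /orP[//|]; rewrite dvdzE /= => /dvdn_leq.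
  by have := odd_prime_gt2 p_odd pp; lia.
have := gre_dvd_odd_power (Gint x y) k_odd; rewrite ebk dvdzE abszX /=.
case/(dvdn_pfactor _ _ pp) => f fm xE.
have pfx : ~~ (p%:Z ^+ f.+1 %| x)%Z.
  by rewrite dvdzE abszX xE /= dvdn_Pexp2l ?prime_gt1 // ltnn.
have pk : (p ^ (m - f) %| k)%N.
  by apply: (dvdn_lifting pp p_odd k_odd px pfx py); rewrite ebk /= subnKC.
have pmk : (p ^ m <= `|x| * k)%N.
  by rewrite xE -{1}(subnKC fm) expnD leq_mul2l dvdn_leq ?orbT // odd_gt0.
have cg : (5 <= `|sqnorm al ^+ g|)%N.
  have c5' : (5 <= `|sqnorm al|)%N by move: c5; clear; case: (sqnorm al).
  rewrite abszX; apply: (leq_trans c5'); rewrite -{1}[`|_|%N]expn1.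
  by rewrite leq_pexp2l ?(odd_gt0 g_odd) // (leq_trans _ c5').
have xg : (`|x| ^ 2 <= `|sqnorm al ^+ g|)%N.
  rewrite -sqnormX eb /sqnorm /= -abszX; move: (sqr_ge0 x) (sqr_ge0 y).
  by move: (x ^+ 2) (y ^+ 2); clear; lia.
(* As [25 * a ^ 2] is at most the total norm, [(p ^ m) ^ 2] is at least 24/25 of it. With [G] the
   norm of [al ^+ g] and [x ^ 2 <= G], this yields [24 * G ^ k.-1 <= 25 * k ^ 2], impossible for
   [k > 2] since [G >= 5]; as [k] is odd, only [k = 1] remains. *)
have bound : (24 * `|sqnorm al ^+ g| ^ k <= 25 * (`|x| * k) ^ 2)%N.
  rewrite -abszX -exprM (mulnC g) -zE.
  have : (24 * `|sqnorm al ^+ z| <= 25 * (p ^ m) ^ 2)%N.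
    move: eqN ac; rewrite -[p%:Z]natz -!natrX natz.
    move: (sqr_ge0 a); move: (_ ^ 2)%N (_ ^+ z) (a ^+ 2); clear; lia.
  by move/leq_trans; apply; rewrite leq_mul2l leq_sqr pmk orbT.
have [k2|k2] := leqP k 2.
  have k1 : k = 1%N by move: k_odd k2; clear; lia.
  by rewrite zE k1 mul1n dvdn_gcdr.
have := expn5_gt_sq k2; rewrite ltnNge => /negP[].
move: cg xg bound; set G := `|_|%N => cg xg bound.
have G0 : (0 < G)%N by rewrite (leq_trans _ cg).
have : (5 ^ k.-1 <= G ^ k.-1)%N by rewrite leq_exp2r // -ltnS (ltn_predK k2) ltnW.
move: bound; rewrite -{1}(ltn_predK k2) expnS expnMn.
move: (G ^ _)%N (5 ^ _)%N (`|x| ^ 2)%N xg (k ^ 2)%N => Q R X xg K bound QR.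
have : (G * (24 * Q) <= G * (25 * K))%N.
  by have : (X * K <= G * K)%N; [rewrite leq_mul2r xg orbT|move: bound; clear; lia].
by rewrite leq_pmul2l //; move: QR; clear; lia.
Qed.

(** The two Gaussian integers differ only by signs, so their squares are equal or conjugate, and
    conjugation merely negates the imaginary part. *)
Lemma gim_even_power_sqr m u v u' v' n :
  u ^+ 2 = u' ^+ 2 -> v ^+ 2 = v' ^+ 2 ->
  (m %| gim (Gint u v ^+ n.*2))%Z -> (m %| gim (Gint u' v' ^+ n.*2))%Z.
Proof.
move=> uu vv; rewrite -mul2n !exprM.
have sq (s t : int) : Gint s t ^+ 2 = Gint (s ^+ 2 - t ^+ 2) (2 * (s * t)).
  by apply: gintP; rewrite expr2 ?greM ?gimM /=; ring.
have [h|h] : u' * v' = u * v \/ u' * v' = - (u * v).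
  by apply/pred2P; rewrite -eqf_sqr !exprMn uu vv.
  by rewrite !sq uu vv h.
rewrite !sq uu vv h mulrN -[Gint _ (- _)]/(gconj (Gint _ _)) -gconjX /= rpredN.
by rewrite -uu -vv.
Qed.

(** * Passing from the equations to Gaussian powers *)

Lemma sum_squares_root (a b c r : nat) :
  coprime a b -> odd r -> odd c -> (a ^ 2 + b ^ 2 = c ^ r)%N ->
  exists u v, Gint b a = Gint u v ^+ r /\ u ^+ 2 + v ^+ 2 = c.
Proof.
move=> cab r_odd c_odd eqc.
have eqz : b%:Z ^+ 2 + a%:Z ^+ 2 = c%:Z ^+ r.
  by rewrite -!natz -!natrX -natrD addnC eqc.
have [||[u v] uvE] := @coprime_sum_squares_power b a c r _ r_odd _ eqz.
- by rewrite coprimez_sym.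
- by rewrite dvdzE /= dvdn2 c_odd.
exists u, v; split=> //; apply/eqP.
rewrite -(@eqrXn2 _ r) ?addr_ge0 ?sqr_ge0 ?odd_gt0 //.
by rewrite -[u ^+ 2 + _]/(sqnorm (Gint u v)) -sqnormX -uvE -eqz.
Qed.

Lemma sqr_25_le (a c e r z : nat) : (5 <= c)%N -> (r.+1 < z)%N ->
  (a ^ 2 + e = c ^ r)%N -> (25 * a ^ 2 <= c ^ z)%N.
Proof.
move=> c5 rz eqc; apply: (@leq_trans (c ^ 2 * c ^ r)); last first.
  by rewrite -expnD leq_pexp2l // (leq_trans _ c5).
by rewrite leq_mul // -?eqc ?leq_addr // (@leq_sqr 5).
Qed.

(** * The case where [b] is a prime power *)

Lemma prime_power_mod4 (p s : nat) : prime p -> (p ^ s %% 4 = 3)%N ->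
  (p %% 4 = 3)%N.
Proof.
move=> pp; rewrite -modnXm; have : (p %% 4 < 4)%N by rewrite ltn_mod.
case: (p %% 4)%N => [|[|[|[|]]]] // _.
- by case: s => [|s] //; rewrite exp0n.
- by rewrite exp1n.
by case: s => [|[|s]] //; rewrite !expnS mulnA -modnMml.
Qed.

Lemma no_solution_b_prime_power (a c p s m r z : nat) :
  prime p -> (p ^ s %% 4 = 3)%N -> coprime a (p ^ s) -> (0 < m)%N ->
  (0 < a)%N -> (5 <= c)%N -> odd c -> odd r -> odd z -> (r < z)%N ->
  (a ^ 2 + (p ^ s) ^ 2 = c ^ r)%N -> (a ^ 2 + (p ^ m) ^ 2 = c ^ z)%N -> False.
Proof.
move=> pp ps4 cop m0 a0 c5 c_odd r_odd z_odd rz eq1 eq2.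
have p4 := prime_power_mod4 pp ps4.
have p_odd : odd p by move: p4; clear; lia.
have s0 : (0 < s)%N by case: s ps4 {cop eq1}.
have copa : coprime a p by move: cop; rewrite coprime_pexpr.
have rz2 : (r.+1 < z)%N by move: r_odd z_odd rz; clear; lia.
have pa : ~~ (p %| a%:Z)%Z by rewrite dvdzE /= -prime_coprime // coprime_sym.
have [u [v [alr Nal]]] := sum_squares_root cop r_odd c_odd eq1.
have copm : coprime a (p ^ m) by rewrite coprimeXr.
have [u' [v' [alz Nal']]] := sum_squares_root copm z_odd c_odd eq2.
have pX n : (p ^ n)%N%:Z = p%:Z ^+ n by rewrite -!natz natrX.
have ac : 25 * a%:Z ^+ 2 <= sqnorm (Gint u' v') ^+ z.
  rewrite -[sqnorm _]/(u' ^+ 2 + v' ^+ 2) Nal' -!natz -!natrX -natrM ler_nat.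
  exact: sqr_25_le c5 rz2 eq1.
have zdvd n : (p %| gim (Gint u' v' ^+ n.*2))%Z -> (z %| n)%N.
  apply: (real_power_mod_order pp p_odd z_odd pa m0 _ _ ac).
    by rewrite -alz pX.
  by rewrite -[sqnorm _]/(u' ^+ 2 + v' ^+ 2) Nal'.
have zp : (z %| p.+1)%N.
  apply: zdvd; rewrite -muln2 exprM; apply: dvdz_trans (gim_dvd_power _ _).
  exact: gim_dvd_frobenius.
(* [z] is odd and divides the even number [p.+1], so [r < z <= p]. *)
have pr : ~~ (p %| r)%N.
  apply/negP => /dvdn_leq; rewrite odd_gt0 // => /(_ isT) pr.
  have := dvdn_leq (ltn0Sn _) zp => zp1.
  by move: z_odd p_odd zp1 pr rz; clear; lia.
(* If [p] divided [u'], the square of [u' + v' i] would be real modulo [p], so [z] would divide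
   1. *)
have pu' : ~~ (p %| u')%Z.
  apply/negP => pu'; have : (z %| 1)%N.
    by apply: zdvd; rewrite expr2 gimM /=; apply: rpredD;
       [apply: dvdz_mulr|apply: dvdz_mull].
  by rewrite dvdn1 => /eqP z1; move: rz; rewrite z1; case: r r_odd {eq1 alr rz2 pr}.
have u'1 : u' ^+ 2 = 1.
  have := gre_dvd_odd_power (Gint u' v') z_odd; rewrite -alz dvdzE /=.
  case/(dvdn_pfactor _ _ pp) => -[_ e|f _ e]; last first.
    by case/negP: pu'; rewrite dvdzE e /= expnS dvdn_mulr.
  by move: e; rewrite expn0; clear; nia.
have va : (v %| a%:Z)%Z by have := gim_dvd_power (Gint u v) r; rewrite -alr.
have va' : (v' %| a%:Z)%Z by have := gim_dvd_power (Gint u' v') z; rewrite -alz.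
have := gre_dvd_odd_power (Gint u v) r_odd; rewrite -alr dvdzE /=.
case/(dvdn_pfactor _ _ pp) => -[_ e|f fs e].
  have uu : u ^+ 2 = u' ^+ 2 by rewrite u'1; move: e; rewrite expn0; clear; nia.
  have vv : v ^+ 2 = v' ^+ 2 by move: Nal'; rewrite -Nal uu => /addrI.
  have /dvdn_leq : (z %| r)%N.
    apply: zdvd; apply: (gim_even_power_sqr uu vv).
    rewrite -muln2 exprM -alr expr2 gimM /= pX.
    by apply: rpredD; [apply: dvdz_mulr|apply: dvdz_mull]; rewrite dvdz_exp.
  by rewrite odd_gt0 // leqNgt rz => /(_ isT).
have pu : (p %| u)%Z by rewrite dvdzE e /= expnS dvdn_mulr.
have puf : ~~ (p%:Z ^+ f.+2 %| u)%Z.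
  by rewrite dvdzE abszX e /= dvdn_Pexp2l ?prime_gt1 // ltnn.
have pv : ~~ (p %| v)%Z by apply: contra pa => /dvdz_trans; apply.
(* [u] has valuation [f.+1] and the real part [p ^ s] of its [r]-th power has valuation [s]; as [p]
   does not divide [r], the two agree. *)
have := dvdn_lifting (k := s - f.+1) pp p_odd r_odd pu puf pv.
rewrite -alr subnKC // /= pX dvdzz => /(_ isT).
case sf: (s - f.+1)%N => [|j]; last first.
  by rewrite expnS => h; case/negP: pr; apply: dvdn_trans h; apply: dvdn_mulr.
move=> _; have sE : s = f.+1 by move: fs sf; clear; lia.
have a2 : (v' ^+ 2 %| a%:Z ^+ 2)%Z by rewrite dvdz_exp2r.
(* [v' ^+ 2 = c - 1] because [u' ^+ 2 = 1], and [c - 1] divides [c ^+ r - 1]. *)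
have c2 : (v' ^+ 2 %| c%:Z ^+ r - 1)%Z.
  by rewrite subrX1 dvdz_mulr // -Nal' u'1 addrAC subrr add0r.
have uE : u ^+ 2 = (p ^ s)%N%:Z ^+ 2.
  by rewrite sE -e; clear; nia.
have eq1z : a%:Z ^+ 2 + u ^+ 2 = c%:Z ^+ r.
  by rewrite uE -!natz -!natrX -natrD eq1.
have dv : (v' ^+ 2 %| u ^+ 2 - 1)%Z.
  have -> : u ^+ 2 - 1 = (c%:Z ^+ r - 1) - a%:Z ^+ 2 by rewrite -eq1z; ring.
  exact: rpredB.
have u2 : 1 < u ^+ 2.
  have : (1 < `|u|)%N.
    by rewrite e expnS (leq_trans (prime_gt1 pp)) // leq_pmulr // expn_gt0 prime_gt0.
  by clear; nia.
have le : v' ^+ 2 <= u ^+ 2 - 1.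
  have := dvdn_leq _ dv; rewrite absz_gt0; move: u2 (sqr_ge0 v'); clear.
  move: (u ^+ 2) (v' ^+ 2) => U V U1 V0 /(_ ltac:(lia)); lia.
have v0 : v = 0.
  apply/eqP; rewrite -sqrf_eq0; move: le Nal Nal' (sqr_ge0 v); rewrite u'1; clear.
  by move: (v ^+ 2) (v' ^+ 2) (u ^+ 2); lia.
by move: va a0; rewrite v0 dvdzE dvd0n /= => /eqP->.
Qed.

(** * The case [a = 2] *)

Lemma no_solution_a_eq2 (b c y r z : nat) :
  odd b -> (2 < b)%N -> (1 < y)%N -> (5 <= c)%N -> odd c -> odd r -> odd z ->
  (2 ^ 2 + b ^ 2 = c ^ r)%N -> (2 ^ 2 + (b ^ y) ^ 2 = c ^ z)%N -> False.
Proof.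
move=> b_odd b2 y1 c5 c_odd r_odd z_odd eq1 eq2.
have cop n : coprime 2 (b ^ n) by rewrite coprimeXr // coprime2n.
have [u [v [alr Nal]]] := sum_squares_root (cop 1%N) r_odd c_odd eq1.
have [u' [v' [alz Nal']]] := sum_squares_root (cop y) z_odd c_odd eq2.
rewrite expn1 in alr.
(* [t] divides 2, and it is even because [s] is odd, as a divisor of a power of [b], and [c] is
   odd. *)
have v4 s t e n : Gint (b ^ e)%N 2 = Gint s t ^+ n -> odd n ->
    s ^+ 2 + t ^+ 2 = c -> t ^+ 2 = 4.
  move=> stn n_odd Nst.
  have := gre_dvd_odd_power (Gint s t) n_odd; rewrite -stn dvdzE /= => sb.
  have := gim_dvd_power (Gint s t) n; rewrite -stn dvdzE /= => t2.
  have s_odd : odd `|s| by apply: dvdn_odd sb _; rewrite oddX b_odd orbT.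
  have Nabs : (`|s| ^ 2 + `|t| ^ 2 = c)%N.
    by apply/eqP; rewrite -eqz_nat -Nst -!mulnn; clear; lia.
  have t_even : ~~ odd `|t|.
    by move: c_odd; rewrite -Nabs oddD !oddX s_odd.
  have tE : `|t|%N = 2%N.
    have := dvdn_leq (isT : 0 < 2)%N t2.
    by move: t2 t_even; case: `|t|%N => [|[|[|]]].
  by move: tE; clear; lia.
have vE : v ^+ 2 = 4 by apply: (v4 u v 1%N r) => //; rewrite expn1.
have vE' : v' ^+ 2 = 4 by apply: (v4 u' v' y z).
have vv : v ^+ 2 = v' ^+ 2 by rewrite vE vE'.
have uu : u ^+ 2 = u' ^+ 2 by apply: (addIr (v ^+ 2)); rewrite Nal vv Nal'.
have br : (b %| gim (Gint u' v' ^+ r.*2))%Z.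
  apply: (gim_even_power_sqr uu vv); rewrite -muln2 exprM -alr expr2 gimM /=.
  by apply: rpredD; [apply: dvdz_mulr|apply: dvdz_mull].
have bz : (b %| gim (Gint u' v' ^+ z.*2))%Z.
  rewrite -muln2 exprM -alz expr2 gimM /=.
  have dby : (b%:Z %| (b ^ y)%N%:Z)%Z by rewrite dvdzE /= dvdn_exp // ltnW.
  by apply: rpredD; [apply: dvdz_mulr|apply: dvdz_mull].
have copc : coprimez b (sqnorm (Gint u' v')).
  rewrite -[sqnorm _]/(u' ^+ 2 + v' ^+ 2) Nal' coprimezE /=.
  rewrite -(@coprime_pexpr r) ?odd_gt0 // -eq1 /coprime addnC -mulnn gcdnMDl.
  by rewrite -/(coprime _ _) coprimeXr // coprimen2.
have := gim_dvd_gcd copc br bz; rewrite -!muln2 -muln_gcdl exprM.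
set g := gcdn r z; case eb: (Gint u' v' ^+ g) => [x t].
have /dvdnP[j rE] : (g %| r)%N by rewrite dvdn_gcdl.
have /dvdnP[k zE] : (g %| z)%N by rewrite dvdn_gcdr.
have [k_odd _] : odd k /\ odd g by apply/andP; rewrite -oddM -zE.
have [j_odd g_odd] : odd j /\ odd g by apply/andP; rewrite -oddM -rE.
have ebk : Gint x t ^+ k = Gint (b ^ y)%N 2 by rewrite -eb -exprM mulnC -zE.
have Nxt : x ^+ 2 + t ^+ 2 = c%:Z ^+ g.
  by rewrite -[LHS]/(sqnorm (Gint x t)) -eb sqnormX; congr (_ ^+ _).
have xb : (x %| (b ^ y)%N%:Z)%Z.
  by have := gre_dvd_odd_power (Gint x t) k_odd; rewrite ebk.
have t2 : (t %| 2)%Z by have := gim_dvd_power (Gint x t) k; rewrite ebk.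
rewrite expr2 gimM /= => bxt.
have bx : (b %| x)%Z.
  have /dvdzP[q qE] := t2; have {}qE : 2 = q * t := qE.
  have : (b %| 2 ^+ 2 * x)%Z.
    have -> : 2 ^+ 2 * x = q * (x * t + t * x).
      by rewrite expr2 -mulrA {1}qE; ring.
    exact: dvdz_mull.
  by rewrite Gauss_dvdzr // coprimezXr // coprimezE /= coprimen2.
have x0 : x != 0.
  apply: contraTneq xb => ->; rewrite dvdzE dvd0n expn_eq0 negb_and -lt0n.
  by rewrite (leq_trans _ b2).
have t4 : t ^+ 2 <= 4.
  by move: (dvdn_leq (isT : 0 < 2)%N t2); rewrite /=; clear; nia.
have /dvdzP[q qE] := bx.
have q1 : 1 <= q ^+ 2.
  have : q != 0 by apply: contraNneq x0 => q0; rewrite qE q0 mul0r.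
  by clear; nia.
have bg : (b ^ 2 <= c ^ g)%N.
  rewrite -lez_nat -!natz !natrX natz natz -Nxt qE exprMn.
  move: (sqr_ge0 t) q1 (sqr_ge0 b%:Z).
  by move: (t ^+ 2) (q ^+ 2) (_ ^+ 2) ; clear => T Q B; nia.
(* Otherwise [(c ^ g) ^ 2 <= c ^ r = 4 + b ^ 2 <= 4 + c ^ g], which fails for [c ^ g >= 5]. Hence
   [g = r], so [r] divides [z]. *)
have j1 : j = 1%N.
  apply: contraTeq j_odd => j1; have [->//|j0] := posnP j.
  have j2 : (1 < j)%N by rewrite ltn_neqAle eq_sym j1.
  have cg5 : (5 <= c ^ g)%N.
    apply: (leq_trans c5); rewrite -{1}(expn1 c).
    by rewrite leq_pexp2l ?(odd_gt0 g_odd) // (leq_trans _ c5).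
  have : ((c ^ g) ^ 2 <= c ^ r)%N.
    by rewrite rE mulnC expnM leq_pexp2l // (leq_trans _ cg5).
  by rewrite -eq1; move: bg cg5; rewrite -mulnn; move: (c ^ g)%N (b ^ 2)%N; clear; nia.
move: rE; rewrite j1 mul1n => rE.
have xE : `|x|%N = b.
  have : x ^+ 2 + t ^+ 2 = 4 + b%:Z ^+ 2.
    by rewrite Nxt -rE -!natz -!natrX -natrD eq1.
  rewrite [in x ^+ 2]qE exprMn => h.
  have q2 : q ^+ 2 < 4 by move: h b2 (sqr_ge0 t); clear; nia.
  have qle : -1 <= q <= 1 by move: q2; clear; nia.
  have qn0 : q != 0 by apply: contraTneq q1 => ->.
  have qa : `|q|%N = 1%N by move: qle qn0; clear; lia.
  by rewrite qE abszM qa; exact: mul1n.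
have b0 : (0 < b)%N by rewrite (leq_trans _ b2).
(* For each prime [p] dividing [b], the real part goes from the valuation of [b] to [y] times that
   valuation, so lifting puts the excess into [k]. *)
have bk : (b ^ y.-1 %| k)%N.
  apply/dvdn_partP; first by rewrite expn_gt0 b0.
  move=> p; rewrite mem_primes => /and3P[pp _].
  rewrite Euclid_dvdX // => /andP[pb _].
  have p_odd : odd p by apply: dvdn_odd pb b_odd.
  have px : (p %| x)%Z by rewrite dvdzE xE.
  rewrite p_part lognX.
  apply: (dvdn_lifting (f := logn p b) (x := x) (y := t) pp p_odd k_odd px).
  - by rewrite dvdzE abszX xE pfactor_dvdn // ltnn.
  - apply/negP => /dvdz_trans /(_ t2); rewrite dvdzE /= => /dvdn_leq.
    by have := odd_prime_gt2 p_odd pp; lia.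
  rewrite ebk dvdzE abszX /= -mulSn prednK ?(ltnW y1) // mulnC.
  by rewrite expnM dvdn_exp2r // pfactor_dvdnn.
have yk : (y <= k)%N.
  have := dvdn_leq (odd_gt0 k_odd) bk; apply: leq_trans.
  by rewrite -[leqLHS](prednK (ltnW y1)) ltn_expl // ltnW.
(* This says [(4 + b ^ 2) ^ y <= 4 + b ^ (2 * y)], but the left side is at least
   [4 * b ^ (2 * (y - 1)) + b ^ (2 * y)], which is larger as [y > 1]. *)
have : ((c ^ r) ^ y <= c ^ z)%N.
  by rewrite -expnM leq_pexp2l ?(leq_trans _ c5) // zE -rE mulnC leq_mul2r yk orbT.
rewrite -eq1 -eq2 leqNgt => /negP; apply.
have -> : ((2 ^ 2 + b ^ 2) ^ y = (2 ^ 2 + b ^ 2) * (2 ^ 2 + b ^ 2) ^ y.-1)%N.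
  by rewrite -expnS (prednK (ltnW y1)).
apply: (@leq_trans ((2 ^ 2 + b ^ 2) * (b ^ 2) ^ y.-1)); last first.
  by rewrite leq_mul2l leq_exp2r ?leq_addl ?orbT // -ltnS (prednK (ltnW y1)).
have -> : ((b ^ y) ^ 2 = b ^ 2 * (b ^ 2) ^ y.-1)%N.
  by rewrite -expnS (prednK (ltnW y1)) -!expnM mulnC.
rewrite mulnDl ltn_add2r -[ltnLHS]muln1 ltn_pmul2l //.
rewrite -{1}(expn0 (b ^ 2)) ltn_exp2l; first by rewrite -ltnS (prednK (ltnW y1)).
by rewrite -{1}(expn0 b) ltn_exp2l // ltnW.
Qed.

(** * Congruences modulo 8 and the reduction to the two cases *)

Lemma odd_sqr_mod8 c : odd c -> (c ^ 2 = 1 %[mod 8])%N.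
Proof.
rewrite -modnXm -[odd c](@odd_mod c 8) //.
have : (c %% 8 < 8)%N by rewrite ltn_mod.
by case: (c %% 8)%N => [|[|[|[|[|[|[|[|]]]]]]]].
Qed.

Lemma odd_power_mod8 c n : odd c -> odd n -> (c ^ n = c %[mod 8])%N.
Proof.
move=> c_odd n_odd; rewrite -(odd_double_half n) n_odd expnS -mul2n expnM.
by rewrite -modnMmr -modnXm odd_sqr_mod8 // modnXm exp1n modnMmr muln1.
Qed.

Close Scope ring_scope.

Theorem theorem1p3 (a b c r z y : nat)
  (ha : 1 < a) (hb : 1 < b) (hc : 1 < c)
  (hr : 1 < r) (hz : 1 < z) (hrodd : odd r) (hzodd : odd z)
  (ha4 : a = 2 %[mod 4]) (hb4 : b = 3 %[mod 4])
  (hab : gcdn a b = 1)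
  (hy : 0 < y) (hyz : (y, z) <> (2, r))
  (hpp : prime_power a \/ prime_power b) :
  ~ (a ^ 2 + b ^ 2 = c ^ r /\ a ^ 2 + b ^ y = c ^ z).
Proof.
move=> [eq1 eq2].
have b_odd : odd b by move: hb4; clear; lia.
have a_even : ~~ odd a by move: ha4; clear; lia.
have c_odd : odd c.
  have : odd (c ^ r) by rewrite -eq1 oddD !oddX (negbTE a_even) b_odd.
  by rewrite oddX => /orP[/eqP r0|//]; rewrite r0 in hr.
have a28 : a ^ 2 = 4 %[mod 8].
  have [q ->] : exists q, a = 4 * q + 2 by exists (a %/ 4); move: ha4; clear; lia.
  have -> : (4 * q + 2) ^ 2 = (2 * q ^ 2 + 2 * q) * 8 + 4.
    by rewrite -!mulnn; clear; lia.
  by rewrite modnMDl.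
have b28 : b ^ 2 = 1 %[mod 8] by exact: odd_sqr_mod8.
have c8 : c = 5 %[mod 8].
  by rewrite -(odd_power_mod8 c_odd hrodd) -eq1 -modnDm a28 b28.
(* For odd [y], [c] would be [4 + b] modulo 8, that is 3 or 7 instead of 5. *)
have y_even : ~~ odd y.
  apply/negP => y_odd; move: c8.
  rewrite -(odd_power_mod8 c_odd hzodd) -eq2 -modnDm a28.
  by rewrite (odd_power_mod8 b_odd y_odd); move: hb4; clear; lia.
have c5 : 5 <= c by move: c8; clear; lia.
have yE : y = (y./2).*2 by rewrite -[LHS](odd_double_half y) (negbTE y_even).
(* If [y = 2], the two left sides coincide, so [z = r], the excluded pair. *)
have h1 : 1 < y./2.
  have [h1|//|h1] := ltngtP y./2 1; exfalso; last first.
    rewrite h1 in yE; apply: hyz; congr pair => //.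
    by apply/eqP; rewrite -(eqn_exp2l _ _ hc) -eq1 -eq2 yE.
  by move: hy; rewrite yE; move: h1; clear; lia.
rewrite yE -muln2 expnM in eq2.
have rz : r < z.
  rewrite -(ltn_exp2l _ _ hc) -eq1 -eq2 ltn_add2l ltn_exp2r //.
  by rewrite -{1}(expn1 b) ltn_exp2l.
case: hpp => [] [p [s [pp s0 E]]].
  (* [a] is even, so its prime is 2, and [a = 2] modulo 4 leaves only the exponent 1. *)
  have p2 : p = 2.
    by apply/eqP; rewrite -[_ == _]negbK; apply: contra a_even => p2;
       rewrite E oddX; case: (even_prime pp) p2 => [->//|->]; rewrite orbT.
  have a2 : a = 2.
    move: ha4; rewrite E p2; case: s s0 {E} => [|[|s]] // _.
    by rewrite !expnS mulnA modnMr.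
  rewrite a2 in eq1 eq2.
  apply: (no_solution_a_eq2 b_odd _ h1 c5 c_odd hrodd hzodd eq1 eq2).
  by move: hb4 hb; clear; lia.
have cop : coprime a (p ^ s) by rewrite -E; apply/eqP.
apply: (@no_solution_b_prime_power a c p s (s * y./2) r z) => //.
- by rewrite -E hb4.
- by rewrite muln_gt0 s0 ltnW.
- exact: ltnW.
- by rewrite -E.
by rewrite expnM -E.
Qed.
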